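(* The system $\mathbf{HK}\Box$ is a conservative extension of $\mathbf{MI_{\Box}}$: for every formula $\phi$ built from proposition letters, $\top$, $\wedge$, $\to$ and $\Box$, we have $\mathbf{HK}\Box\vdash\phi$ if and only if $\mathbf{MI_{\Box}}\vdash\phi$.
   Context: $\mathbf{MI_{\Box}}$ is derived by modus ponens from substitution instances of $p\to(q\to p)$, $(p\to(q\to r))\to((p\to q)\to(p\to r))$, $(p\wedge q)\to p$, $(p\wedge q)\to q$, $p\to(q\to(p\wedge q))$, $\top$, $\Box(p\wedge q)\leftrightarrow(\Box p\wedge\Box q)$, $\Box\top\leftrightarrow\top$, closed under the rule from $p\leftrightarrow q$ infer $\Box p\leftrightarrow\Box q$. $\mathbf{HK}\Box$ is the modal intuitionistic logic of Božić and Došen in the language of intuitionistic propositional logic extended with $\Box$, axiomatised over intuitionistic logic by $\Box(p\wedge q)\leftrightarrow(\Box p\wedge\Box q)$ and $\Box\top\leftrightarrow\top$; it is sound and complete with respect to $H\Box$-frames: tuples $(X,\leq,R)$ with $\leq$ a preorder and $R$ a relation satisfying $({\leq}\circ R)\subseteq(R\circ{\leq})$ (where $x(R_1\circ R_2)z$ iff $\exists y$, $xR_1y$, $yR_2z$), with valuations assigning up-closed sets, intuitionistic connectives interpreted as in Kripke semantics, and $x\Vdash\Box\phi$ iff every $y$ with $xRy$ satisfies $\phi$. *)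

(* Defs.v *)
(* Proposition letters range over an arbitrary type [V].  Axioms are given as
   schemata: each constructor ranges over all formulas substituted for the
   letters p, q, r, so the theorems are closed under uniform substitution. *)

(* Formulas built from proposition letters, top, conjunction, implication, box. *)
Inductive mi_form (V : Type) : Type :=
| MVar (p : V)
| MTop
| MAnd (phi psi : mi_form V)
| MImp (phi psi : mi_form V)
| MBox (phi : mi_form V).

Arguments MVar {V} p.
Arguments MTop {V}.
Arguments MAnd {V} phi psi.
Arguments MImp {V} phi psi.
Arguments MBox {V} phi.

Definition MIff {V : Type} (phi psi : mi_form V) : mi_form V :=
  MAnd (MImp phi psi) (MImp psi phi).

(* Derivations stay inside the fragment: no bottom or disjunction may occur. *)
Inductive MI_prov {V : Type} : mi_form V -> Prop :=
| MI_K p q : MI_prov (MImp p (MImp q p))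
| MI_S p q r :
    MI_prov (MImp (MImp p (MImp q r)) (MImp (MImp p q) (MImp p r)))
| MI_and_l p q : MI_prov (MImp (MAnd p q) p)
| MI_and_r p q : MI_prov (MImp (MAnd p q) q)
| MI_and_i p q : MI_prov (MImp p (MImp q (MAnd p q)))
| MI_top : MI_prov MTop
| MI_box_and p q :
    MI_prov (MIff (MBox (MAnd p q)) (MAnd (MBox p) (MBox q)))
| MI_box_top : MI_prov (MIff (MBox MTop) MTop)
| MI_mp p q : MI_prov (MImp p q) -> MI_prov p -> MI_prov q
| MI_cong p q : MI_prov (MIff p q) -> MI_prov (MIff (MBox p) (MBox q)).

(* The full intuitionistic language with box; negation is [HImp phi HBot]. *)
Inductive hk_form (V : Type) : Type :=
| HVar (p : V)
| HTop
| HBot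
| HAnd (phi psi : hk_form V)
| HOr (phi psi : hk_form V)
| HImp (phi psi : hk_form V)
| HBox (phi : hk_form V).

Arguments HVar {V} p.
Arguments HTop {V}.
Arguments HBot {V}.
Arguments HAnd {V} phi psi.
Arguments HOr {V} phi psi.
Arguments HImp {V} phi psi.
Arguments HBox {V} phi.

Definition HIff {V : Type} (phi psi : hk_form V) : hk_form V :=
  HAnd (HImp phi psi) (HImp psi phi).

(* A Hilbert calculus for intuitionistic logic with the two box axioms and the
   congruence rule.  Given [HK_box_and], congruence is interderivable with
   monotonicity (from p -> q infer Box p -> Box q). *)
Inductive HK_prov {V : Type} : hk_form V -> Prop :=
| HK_K p q : HK_prov (HImp p (HImp q p))
| HK_S p q r :
    HK_prov (HImp (HImp p (HImp q r)) (HImp (HImp p q) (HImp p r)))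
| HK_and_l p q : HK_prov (HImp (HAnd p q) p)
| HK_and_r p q : HK_prov (HImp (HAnd p q) q)
| HK_and_i p q : HK_prov (HImp p (HImp q (HAnd p q)))
| HK_top : HK_prov HTop
| HK_or_l p q : HK_prov (HImp p (HOr p q))
| HK_or_r p q : HK_prov (HImp q (HOr p q))
| HK_or_e p q r :
    HK_prov (HImp (HImp p r) (HImp (HImp q r) (HImp (HOr p q) r)))
| HK_bot p : HK_prov (HImp HBot p)
| HK_box_and p q :
    HK_prov (HIff (HBox (HAnd p q)) (HAnd (HBox p) (HBox q)))
| HK_box_top : HK_prov (HIff (HBox HTop) HTop)
| HK_mp p q : HK_prov (HImp p q) -> HK_prov p -> HK_prov q
| HK_cong p q : HK_prov (HIff p q) -> HK_prov (HIff (HBox p) (HBox q)).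

Fixpoint embed {V : Type} (phi : mi_form V) : hk_form V :=
  match phi with
  | MVar p => HVar p
  | MTop => HTop
  | MAnd phi psi => HAnd (embed phi) (embed psi)
  | MImp phi psi => HImp (embed phi) (embed psi)
  | MBox phi => HBox (embed phi)
  end.

(* Main.v *)
(** The nontrivial direction builds a canonical [H Box]-model out of MI alone.
    Its worlds are all the MI-theories, ordered by inclusion, with [x R y] iff
    [{phi | Box phi in x}] is included in [y].  Since the fragment has no
    disjunction, no primeness is needed: [x + phi] witnesses the failure of an
    implication in [x], and [{phi | Box phi in x}] is itself a theory, which
    witnesses the failure of a box.  Hence the truth lemma holds at every
    theory, for formulas of the fragment, and a theorem of HK, being true in
    the model by soundness, belongs to the least theory. *)

From Stdlib Require Import Setoid.
Require Import Defs.

Lemma HK_prov_embed {V : Type} (phi : mi_form V) :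
  MI_prov phi -> HK_prov (embed phi).
Proof.
induction 1; simpl; try (now constructor).
now apply HK_mp with (embed p).
Qed.

Section Kripke.

Context {V W : Type} (le R : W -> W -> Prop) (val : V -> W -> Prop).

Fixpoint forces (phi : hk_form V) (x : W) : Prop :=
  match phi with
  | HVar p => val p x
  | HTop => True
  | HBot => False
  | HAnd phi psi => forces phi x /\ forces psi x
  | HOr phi psi => forces phi x \/ forces psi x
  | HImp phi psi => forall y, le x y -> forces phi y -> forces psi y
  | HBox phi => forall y, R x y -> forces phi y
  end.

Hypothesis le_refl : forall x, le x x.
Hypothesis le_trans : forall x y z, le x y -> le y z -> le x z.
Hypothesis le_R : forall x y z, le x y -> R y z -> exists u, R x u /\ le u z.
Hypothesis val_up : forall p x y, le x y -> val p x -> val p y.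

(** The box case is where [le_R] enters: an [R]-successor [z] of [y] lies above some [R]-successor
    [u] of [x], and the induction hypothesis carries truth from [u] to [z]. *)
Lemma forces_up phi x y : le x y -> forces phi x -> forces phi y.
Proof.
revert x y; induction phi; simpl; intros x y Hxy H; eauto.
- destruct H; eauto.
- destruct H; eauto.
- intros z Hyz; destruct (le_R _ _ _ Hxy Hyz) as [u [Hxu Huz]]; eauto.
Qed.

Lemma HK_sound phi : HK_prov phi -> forall x, forces phi x.
Proof.
(* Persistence validates [HK_K] and [HK_and_i], whose first antecedent must survive the move to a
   later world. *)
induction 1; simpl in *; intros x; eauto using forces_up.
- now intros y _ [].
- now intros y _ [].
- intros y _ Hpr z Hyz Hqr u Hzu [Hp | Hq]; eauto.
- now intros y _ [].
- split.
  + intros y _ Hpq; split; intros z Hyz; now apply Hpq.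
  + intros y _ [Hp Hq] z Hyz; auto.
- split; intros y _ Hb z Hyz; destruct (IHHK_prov z); auto.
Qed.

End Kripke.

Section MI.

Context {V : Type}.
Implicit Types p q r : mi_form V.

Lemma MI_id p : MI_prov (MImp p p).
Proof.
apply MI_mp with (MImp p (MImp p p)); [| apply MI_K].
apply MI_mp with (MImp p (MImp (MImp p p) p)); [apply MI_S | apply MI_K].
Qed.

Lemma MI_weaken p q : MI_prov q -> MI_prov (MImp p q).
Proof. apply MI_mp, MI_K. Qed.

Lemma MI_mp_under p q r :
  MI_prov (MImp p (MImp q r)) -> MI_prov (MImp p q) -> MI_prov (MImp p r).
Proof. intros H; apply MI_mp; revert H; apply MI_mp, MI_S. Qed.

Lemma MI_trans p q r :
  MI_prov (MImp p q) -> MI_prov (MImp q r) -> MI_prov (MImp p r).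
Proof. intros Hpq Hqr; apply MI_mp_under with q; auto using MI_weaken. Qed.

Lemma MI_conj p q : MI_prov p -> MI_prov q -> MI_prov (MAnd p q).
Proof. intros Hp; apply MI_mp; revert Hp; apply MI_mp, MI_and_i. Qed.

Lemma MI_conj_under p q r :
  MI_prov (MImp r p) -> MI_prov (MImp r q) -> MI_prov (MImp r (MAnd p q)).
Proof.
intros Hp Hq; apply MI_mp_under with q; auto.
apply MI_trans with p; [auto | apply MI_and_i].
Qed.

Lemma MI_iff_l p q : MI_prov (MIff p q) -> MI_prov (MImp p q).
Proof. apply MI_mp, MI_and_l. Qed.

Lemma MI_iff_r p q : MI_prov (MIff p q) -> MI_prov (MImp q p).
Proof. apply MI_mp, MI_and_r. Qed.

(** If [p] implies [q], then [p] is equivalent to [MAnd p q]; congruence transfers this under the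
    box, and the box distributes over the conjunction. *)
Lemma MI_box_mono p q : MI_prov (MImp p q) -> MI_prov (MImp (MBox p) (MBox q)).
Proof.
intros Hpq; apply MI_trans with (MBox (MAnd p q)).
- apply MI_iff_l, MI_cong, MI_conj; [| apply MI_and_l].
  apply MI_conj_under; [apply MI_id | exact Hpq].
- apply MI_trans with (MAnd (MBox p) (MBox q)); [| apply MI_and_r].
  apply MI_iff_l, MI_box_and.
Qed.

Lemma MI_nec p : MI_prov p -> MI_prov (MBox p).
Proof.
intros Hp; apply MI_mp with (MBox MTop).
- apply MI_box_mono, MI_weaken, Hp.
- apply MI_mp with MTop; [apply MI_iff_r, MI_box_top | apply MI_top].
Qed.

Lemma MI_box_K p q :
  MI_prov (MImp (MBox (MImp p q)) (MImp (MBox p) (MBox q))).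
Proof.
assert (H : MI_prov (MImp (MAnd (MBox (MImp p q)) (MBox p)) (MBox q))).
{ apply MI_trans with (MBox (MAnd (MImp p q) p)).
  - apply MI_iff_r, MI_box_and.
  - apply MI_box_mono, MI_mp_under with p; [apply MI_and_l | apply MI_and_r]. }
(* Currying turns [H] into the nested implication. *)
eapply MI_trans; [apply MI_and_i |].
eapply MI_mp; [apply MI_S | apply MI_weaken, H].
Qed.

Definition theory (T : mi_form V -> Prop) : Prop :=
  (forall p, MI_prov p -> T p) /\ (forall p q, T (MImp p q) -> T p -> T q).

Lemma theory_MI : theory MI_prov.
Proof. split; [auto | apply MI_mp]. Qed.

(* By the deduction theorem, this is the theory generated by [T] and [p]. *)
Lemma theory_extend T p : theory T -> theory (fun q => T (MImp p q)).
Proof.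
intros [Hth Hmp]; split.
- intros q Hq; apply Hth, MI_weaken, Hq.
- intros q r Hqr; apply Hmp; revert Hqr; apply Hmp, Hth, MI_S.
Qed.

Lemma theory_unbox T : theory T -> theory (fun q => T (MBox q)).
Proof.
intros [Hth Hmp]; split.
- intros q Hq; apply Hth, MI_nec, Hq.
- intros q r Hqr; apply Hmp; revert Hqr; apply Hmp, Hth, MI_box_K.
Qed.

(** The theory of all formulas is a world too. This is harmless: [HBot], forced nowhere, is outside
    the image of [embed]. *)
Definition world : Type := {T : mi_form V -> Prop | theory T}.

Definition mem (p : mi_form V) (x : world) : Prop := proj1_sig x p.

Definition world_le (x y : world) : Prop := forall p, mem p x -> mem p y.

Definition world_R (x y : world) : Prop := forall p, mem (MBox p) x -> mem p y.

Lemma truth p (x : world) :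
  forces world_le world_R (fun v => mem (MVar v)) (embed p) x <-> mem p x.
Proof.
revert x; induction p as [v | | p IHp q IHq | p IHp q IHq | p IHp];
  simpl; intros [T HT]; pose proof HT as [Hth Hmp].
- tauto.
- split; auto; intros _; apply Hth, MI_top.
- rewrite IHp, IHq; cbn; split.
  + intros [Hp Hq]; revert Hq; apply Hmp; revert Hp; apply Hmp, Hth, MI_and_i.
  + intros H; split; revert H; apply Hmp, Hth; [apply MI_and_l | apply MI_and_r].
- split.
  + intros H; apply (IHq (exist _ _ (theory_extend T p HT))), H.
    (* The extension of [T] by [p] lies above [T], and it contains [p]. *)
    * intros r; apply Hmp, Hth, MI_K.
    * apply IHp, Hth, MI_id.
  + intros H y Hxy; rewrite IHp, IHq; apply (proj2_sig y), Hxy, H.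
- split.
  + intros H; apply (IHp (exist _ _ (theory_unbox T HT))), H.
    intros r; exact (fun Hr => Hr).
  + intros H y Hxy; apply IHp, Hxy, H.
Qed.

End MI.

Theorem theorem6p2 (V : Type) (phi : mi_form V) :
  HK_prov (embed phi) <-> MI_prov phi.
Proof.
split; [| apply HK_prov_embed].
intros H; apply (truth phi (exist _ _ theory_MI)).
apply HK_sound; trivial.
- now intros x p.
- intros x y z Hxy Hyz p Hp; apply Hyz, Hxy, Hp.
(* Here [z] is already an [R]-successor of [x], since a larger theory has more boxed members and so
   fewer successors. *)
- intros x y z Hxy Hyz; exists z; split; [| now intros p].
  intros p Hp; apply Hyz, Hxy, Hp.
- intros v x y Hxy; apply Hxy.
Qed.
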